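(* Let $X$ be a compact metric space with metric $d$, let $f\colon X\to X$ be a continuous map with the s-limit shadowing property, let $C\in\mathcal{C}(f)$ and $D\in\mathcal{D}(C)$. Let $\mathcal{F},\mathcal{G}$ be full Furstenberg families which are compatible with $(X^n,f^{\times n})$ for all $n\ge2$, and suppose $\mathcal{F}$ is translation invariant. Let $n\ge2$ and $\delta>0$. If there is an $n$-tuple $(a_1,\dots,a_n)\in[V^s(D)]^n$ with $S_f(a_1,\dots,a_n;\delta)\in\mathcal{F}$, then for every $E\in\mathcal{D}(C)$ and every $0<r<\delta$, $V^s(E)$ is generic $(\mathcal{F},\mathcal{G})$-$n$-$r$-chaotic for $f$.
   Context: A $\delta$-chain of $f$ ($\delta>0$) is a finite sequence $(x_i)_{i=0}^k$, $k\ge1$, with $d(f(x_i),x_{i+1})\le\delta$ for $0\le i\le k-1$; it is a $\delta$-cycle if $x_0=x_k$, with length $k$. Write $x\to y$ if for every $\delta>0$ there is a $\delta$-chain from $x$ to $y$. Let $CR(f)=\{x\colon x\to x\}$; on $CR(f)$ let $x\leftrightarrow y$ iff $x\to y$ and $y\to x$; its classes are the chain components, forming $\mathcal{C}(f)$. For $C\in\mathcal{C}(f)$, $\delta>0$, let $m=m(C,\delta)$ be the gcd of the lengths of all $\delta$-cycles of $f|_C$, and for $x,y\in C$ let $x\sim_{C,\delta}y$ iff there is a $\delta$-chain of $f|_C$ from $x$ to $y$ of length divisible by $m$; $\mathcal{D}(C,\delta)$ is the set of its equivalence classes. Let $x\sim_C y$ iff $x\sim_{C,\delta}y$ for all $\delta>0$;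 $\mathcal{D}(C)$ is its set of classes. For $D\in\mathcal{D}(C)$, $D_\delta$ is the element of $\mathcal{D}(C,\delta)$ containing $D$. $W^s(C)=\{x\colon\lim_i d(f^i(x),C)=0\}$ and $V^s(D)=\bigcap_{\delta>0}\{x\in W^s(C)\colon\lim_i d(f^i(x),f^i(D_\delta))=0\}$. $f$ has the s-limit shadowing property if for every $\epsilon>0$ there is $\delta>0$ such that for every sequence $(x_i)_{i\ge0}$ with $d(f(x_i),x_{i+1})\le\delta$ for all $i$ and $d(f(x_i),x_{i+1})\to0$ there is $x\in X$ with $d(f^i(x),x_i)\le\epsilon$ for all $i$ and $d(f^i(x),x_i)\to0$. A Furstenberg family is a nonempty proper family $\mathcal{F}\subsetneq 2^{\mathbb{N}_0}$ closed under taking supersets; it is full if $\{i\in A\colon i\ge n\}\in\mathcal{F}$ for all $A\in\mathcal{F}$, $n\ge0$; translation invariant if $\{i+n\colon i\in A\}\in\mathcal{F}$ and $\{i\in\mathbb{N}_0\colon i+n\in A\}\in\mathcal{F}$ for all $A\in\mathcal{F}$, $n\ge0$. $f^{\times n}\colon X^n\to X^n$ is the $n$-fold product map. $\mathcal{F}$ is compatible with $(X^n,f^{\times n})$ if for every open $U\subset X^n$ the set $\{z\in X^n\colon\{i\in\mathbb{N}_0\colon (f^{\times n})^i(z)\in U\}\in\mathcal{F}\}$ is a $G_\delta$-subset of $X^n$. For $x_1,\dots,x_n\in X$, $r>0$: $S_f(x_1,\dots,x_n;r)=\{i\in\mathbb{N}_0\colon\min_{j<k}d(f^i(x_j),f^i(x_k))>r\}$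 and $T_f(x_1,\dots,x_n;r)=\{i\in\mathbb{N}_0\colon\max_{j<k}d(f^i(x_j),f^i(x_k))<r\}$. $(x_1,\dots,x_n)$ is $(\mathcal{F},\mathcal{G})$-$r$-scrambled for $f$ if $S_f(x_1,\dots,x_n;r)\in\mathcal{F}$ and $T_f(x_1,\dots,x_n;\epsilon)\in\mathcal{G}$ for all $\epsilon>0$. A nonempty $Y\subset X$ is generic $(\mathcal{F},\mathcal{G})$-$n$-$r$-chaotic for $f$ if the set of $(\mathcal{F},\mathcal{G})$-$r$-scrambled $n$-tuples in $Y^n$ is residual in $Y^n$ (i.e. contains a countable intersection of dense open subsets of $Y^n$ in the subspace topology). *)

(* Defs.v *)
From Stdlib Require Import Reals List Arith.
Open Scope R_scope.

Section Defs.
Variable X : Type.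
Variable d : X -> X -> R.

Definition is_metric : Prop :=
  (forall x y, 0 <= d x y) /\
  (forall x y, d x y = 0 <-> x = y) /\
  (forall x y, d x y = d y x) /\
  (forall x y z, d x z <= d x y + d y z).

Definition open_set (U : X -> Prop) : Prop :=
  forall x, U x -> exists e, 0 < e /\ forall y, d x y < e -> U y.

Definition compact_space : Prop :=
  forall (I : Type) (U : I -> X -> Prop),
    (forall i, open_set (U i)) -> (forall x, exists i, U i x) ->
    exists l : list I, forall x, exists i, In i l /\ U i x.

Definition continuous_map (f : X -> X) : Prop :=
  forall x e, 0 < e -> exists dl, 0 < dl /\
    forall y, d x y < dl -> d (f x) (f y) < e.

Definition iter (f : X -> X) (i : nat) (x : X) : X := Nat.iter i f x.

(** delta-chains of f whose points lie in P (P = everything for f itself,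
    P = C for f|_C), from x to y, of length k >= 1. *)
Definition chain_in (f : X -> X) (P : X -> Prop) (delta : R) (x y : X) (k : nat)
  : Prop :=
  (1 <= k)%nat /\
  exists xs : nat -> X, xs 0%nat = x /\ xs k = y /\
    (forall i, (i <= k)%nat -> P (xs i)) /\
    (forall i, (i < k)%nat -> d (f (xs i)) (xs (S i)) <= delta).

Definition chain_to (f : X -> X) (x y : X) : Prop :=
  forall delta, 0 < delta -> exists k, chain_in f (fun _ => True) delta x y k.

Definition chain_recurrent (f : X -> X) (x : X) : Prop := chain_to f x x.

Definition chain_component (f : X -> X) (C : X -> Prop) : Prop :=
  exists x, chain_recurrent f x /\
    forall y, C y <-> (chain_recurrent f y /\ chain_to f x y /\ chain_to f y x).

Definition cycle_gcd (f : X -> X) (C : X -> Prop) (delta : R) (m : nat) : Prop :=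
  (forall x k, C x -> chain_in f C delta x x k -> Nat.divide m k) /\
  (forall m', (forall x k, C x -> chain_in f C delta x x k -> Nat.divide m' k) ->
     Nat.divide m' m).

Definition sim_Cdelta (f : X -> X) (C : X -> Prop) (delta : R) (x y : X) : Prop :=
  C x /\ C y /\
  exists m, cycle_gcd f C delta m /\
    exists k, Nat.divide m k /\ chain_in f C delta x y k.

Definition sim_C (f : X -> X) (C : X -> Prop) (x y : X) : Prop :=
  forall delta, 0 < delta -> sim_Cdelta f C delta x y.

Definition D_class (f : X -> X) (C : X -> Prop) (D : X -> Prop) : Prop :=
  exists x, C x /\ forall y, D y <-> (C y /\ sim_C f C x y).

(** lim_i d(f^i(x), f^i(A)) = 0, with d(z,A) = inf_{a in A} d(z,a) unfolded. *)
Definition dist_orbit_to_zero (f : X -> X) (x : X) (A : X -> Prop) : Prop :=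
  forall e, 0 < e -> exists N, forall i, (N <= i)%nat ->
    exists a, A a /\ d (iter f i x) (iter f i a) < e.

Definition Ws (f : X -> X) (C : X -> Prop) (x : X) : Prop :=
  forall e, 0 < e -> exists N, forall i, (N <= i)%nat ->
    exists c, C c /\ d (iter f i x) c < e.

(** V^s(D), where D_delta is the ~_{C,delta}-class of any point y of D. *)
Definition Vs (f : X -> X) (C D : X -> Prop) (x : X) : Prop :=
  forall delta, 0 < delta ->
    Ws f C x /\
    forall y, D y -> dist_orbit_to_zero f x (fun z => sim_Cdelta f C delta y z).

Definition s_limit_shadowing (f : X -> X) : Prop :=
  forall eps, 0 < eps -> exists delta, 0 < delta /\
    forall xs : nat -> X,
      (forall i, d (f (xs i)) (xs (S i)) <= delta) ->
      (forall e, 0 < e -> exists N, forall i, (N <= i)%nat ->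
          d (f (xs i)) (xs (S i)) < e) ->
      exists x, (forall i, d (iter f i x) (xs i) <= eps) /\
        (forall e, 0 < e -> exists N, forall i, (N <= i)%nat ->
            d (iter f i x) (xs i) < e).

(** n-tuples: functions from {0,...,n-1} to X; X^n carries the product
    topology, given by the max metric. *)
Definition Idx (n : nat) : Type := {i : nat | (i < n)%nat}.
Definition tuple (n : nat) : Type := Idx n -> X.

Definition prod_iter (f : X -> X) (n : nat) (i : nat) (z : tuple n) : tuple n :=
  fun j => iter f i (z j).

Definition close_n (n : nat) (z w : tuple n) (e : R) : Prop :=
  forall j, d (z j) (w j) < e.

Definition open_n (n : nat) (U : tuple n -> Prop) : Prop :=
  forall z, U z -> exists e, 0 < e /\ forall w, close_n n z w e -> U w.

Definition G_delta_n (n : nat) (A : tuple n -> Prop) : Prop :=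
  exists O : nat -> tuple n -> Prop, (forall k, open_n n (O k)) /\
    forall z, A z <-> forall k, O k z.

Definition power_set_n (n : nat) (Y : X -> Prop) (z : tuple n) : Prop :=
  forall j, Y (z j).

Definition rel_open_n (n : nat) (Y : X -> Prop) (O : tuple n -> Prop) : Prop :=
  (forall z, O z -> power_set_n n Y z) /\
  forall z, O z -> exists e, 0 < e /\
    forall w, power_set_n n Y w -> close_n n z w e -> O w.

Definition rel_dense_n (n : nat) (Y : X -> Prop) (O : tuple n -> Prop) : Prop :=
  forall z e, power_set_n n Y z -> 0 < e ->
    exists w, O w /\ close_n n z w e.

Definition residual_in_n (n : nat) (Y : X -> Prop) (A : tuple n -> Prop) : Prop :=
  exists O : nat -> tuple n -> Prop,
    (forall k, rel_open_n n Y (O k)) /\ (forall k, rel_dense_n n Y (O k)) /\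
    (forall z, (forall k, O k z) -> A z).
End Defs.

Definition ffamily := (nat -> Prop) -> Prop.

Definition furstenberg (F : ffamily) : Prop :=
  (exists A, F A) /\ (exists A, ~ F A) /\
  (forall A B : nat -> Prop, F A -> (forall i, A i -> B i) -> F B).

Definition full_family (F : ffamily) : Prop :=
  forall A n, F A -> F (fun i => A i /\ (n <= i)%nat).

Definition translation_invariant (F : ffamily) : Prop :=
  forall A n, F A ->
    F (fun j => exists i, A i /\ j = (i + n)%nat) /\ F (fun i => A (i + n)%nat).

Definition compatible {X : Type} (d : X -> X -> R) (f : X -> X) (F : ffamily)
  (n : nat) : Prop :=
  forall U : tuple X n -> Prop, open_n X d n U ->
    G_delta_n X d n (fun z => F (fun i => U (prod_iter X f n i z))).

Definition S_f {X : Type} (d : X -> X -> R) (f : X -> X) (n : nat)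
  (z : tuple X n) (r : R) : nat -> Prop :=
  fun i => forall j k : Idx n, (proj1_sig j < proj1_sig k)%nat ->
    d (iter X f i (z j)) (iter X f i (z k)) > r.

Definition T_f {X : Type} (d : X -> X -> R) (f : X -> X) (n : nat)
  (z : tuple X n) (r : R) : nat -> Prop :=
  fun i => forall j k : Idx n, (proj1_sig j < proj1_sig k)%nat ->
    d (iter X f i (z j)) (iter X f i (z k)) < r.

Definition scrambled {X : Type} (d : X -> X -> R) (f : X -> X) (F G : ffamily)
  (n : nat) (r : R) (z : tuple X n) : Prop :=
  F (S_f d f n z r) /\ forall e, 0 < e -> G (T_f d f n z e).

Definition generic_chaotic {X : Type} (d : X -> X -> R) (f : X -> X)
  (F G : ffamily) (n : nat) (r : R) (Y : X -> Prop) : Prop :=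
  (exists y, Y y) /\ residual_in_n X d n Y (scrambled d f F G n r).

(* Main.v *)
(** The set of tuples [z] with [S_f z r] in [F] is by compatibility an
    intersection of open sets [O_l], so it is enough to show that each [O_l]
    meets [V^s(E)^n] densely; no single tuple of [V^s(E)^n] near a given one has
    to lie in all of them.  Given [z] in [V^s(E)^n], [u] in [E] and [N], one
    builds pseudo-orbits which start at [z_j], reach [f^t(a_j)] at a time [s] by
    chains in [C], follow the orbit of [a_j] for [N] steps and then return to the
    orbit of [u] with the right phase.  Here [s] and [t] depend neither on [j]
    nor on [N], because modulo the gcd of the cycle lengths all large lengths of
    chains between two points of [C] occur.  Their limit shadows [v_N] are
    asymptotic to [u], hence in [V^s(E)^n].  A cluster point [w] of the [v_N]
    follows [f^t(a)] forever up to a small error, so it lies in every [O_l] by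
    translation invariance, although it need not lie in [V^s(E)^n]; so [v_N] is
    in [O_l] for some [N].  For [G], all coordinates of [v_N] are asymptotic to
    [u], so its proximality sets are cofinite. *)
Require Import Defs.
From Stdlib Require Import Reals Lra Lia Arith List Classical ClassicalEpsilon Cantor.
Open Scope R_scope.

(** * Arithmetic of natural numbers: common divisors and additive sets *)

Lemma small_inv (e : R) : 0 < e ->
  exists N : nat, forall k, (N <= k)%nat -> / INR (S k) < e.
Proof.
  intros He. destruct (archimed_cor1 e He) as [N [HN HN0]].
  exists N. intros k Hk. apply Rle_lt_trans with (/ INR N); [|exact HN].
  apply Rinv_le_contravar; [apply lt_0_INR; lia | apply le_INR; lia].
Qed.

Lemma inv_INR_S_pos (k : nat) : 0 < / INR (S k).
Proof. apply Rinv_0_lt_compat, lt_0_INR; lia. Qed.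

Lemma least_nat (P : nat -> Prop) (n : nat) : P n ->
  exists k, P k /\ forall j, (j < k)%nat -> ~ P j.
Proof.
  induction n as [n IH] using lt_wf_ind. intros Hn.
  destruct (classic (exists j, (j < n)%nat /\ P j)) as [[j [Hj Pj]]|Hno].
  - exact (IH j Hj Pj).
  - exists n. split; [exact Hn|]. intros j Hj Pj. apply Hno. now exists j.
Qed.

(** Take the least positive [g] that every common divisor of [A] divides. For [x] in [A] the gcd of
    [g] and [x] has the same property, so minimality forces it to equal [g]. If [A] has no positive
    element, 0 serves. *)
Lemma gcd_exists (A : nat -> Prop) : exists m,
  (forall s, A s -> Nat.divide m s) /\
  (forall m', (forall s, A s -> Nat.divide m' s) -> Nat.divide m' m).
Proof.
  destruct (classic (exists s, A s /\ (0 < s)%nat)) as [[s [Hs Hpos]]|Hno].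
  - set (Q g := (0 < g)%nat /\
      forall m', (forall s, A s -> Nat.divide m' s) -> Nat.divide m' g).
    destruct (least_nat Q s) as [g [[Hg Hdiv] Hmin]].
    { split; [exact Hpos|]. intros m' Hm'. now apply Hm'. }
    exists g. split; [|exact Hdiv]. intros x Hx.
    assert (Hle : (Nat.gcd g x = g)%nat).
    { assert (Hgp : (Nat.gcd g x <> 0)%nat).
      { intros H0. apply Nat.gcd_eq_0_l in H0. lia. }
      assert (Hgle : (Nat.gcd g x <= g)%nat).
      { apply Nat.divide_pos_le; [exact Hg | apply Nat.gcd_divide_l]. }
      destruct (Nat.eq_dec (Nat.gcd g x) g) as [|Hne]; [assumption|].
      exfalso. apply (Hmin (Nat.gcd g x)); [lia|]. split; [lia|].
      intros m' Hm'. apply Nat.gcd_greatest; [now apply Hdiv | now apply Hm']. }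
    rewrite <- Hle. apply Nat.gcd_divide_r.
  - exists 0%nat. split.
    + intros s Hs. destruct s as [|s]; [exists 0%nat; lia|].
      exfalso. apply Hno. exists (S s). split; [exact Hs | lia].
    + intros m' _. exists 0%nat. lia.
Qed.

Lemma additive_mul (A : nat -> Prop) (s q : nat) :
  (forall a b, A a -> A b -> A (a + b)%nat) -> A s -> (0 < q)%nat -> A (q * s)%nat.
Proof.
  intros Hadd Hs. induction q as [|q IH]; [lia|]. intros _.
  destruct q as [|q]; [now rewrite Nat.mul_1_l|].
  simpl in *. apply Hadd; [exact Hs | apply IH; lia].
Qed.

(* The least positive difference [g = s1 - s2] of two elements divides every
   element, so it is the gcd; writing [s2 = m * c], the multiples
   [m * (a * c + b) = (a - b) * s2 + b * s1] with [b < c <= a] all occur. *)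
Lemma additive_eventually (A : nat -> Prop) (m : nat) :
  (forall a b, A a -> A b -> A (a + b)%nat) ->
  (exists s, A s /\ (0 < s)%nat) ->
  (forall s, A s -> Nat.divide m s) ->
  (forall m', (forall s, A s -> Nat.divide m' s) -> Nat.divide m' m) ->
  exists Q, forall q, (Q <= q)%nat -> A (m * q)%nat.
Proof.
  intros Hadd [s [Hs Hspos]] Hdiv Hgcd.
  set (P g := (0 < g)%nat /\ exists s1 s2, A s1 /\ A s2 /\ s1 = (s2 + g)%nat).
  destruct (least_nat P s) as [g [[Hg (s1 & s2 & H1 & H2 & H12)] Hmin]].
  { split; [exact Hspos|]. exists (s + s)%nat, s. auto. }
  assert (Hgm : Nat.divide g m).
  { apply Hgcd. intros x Hx. apply Nat.Lcm0.mod_divide.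
    destruct (Nat.eq_dec (x mod g) 0) as [|Hne]; [assumption|].
    exfalso. apply (Hmin (x mod g)); [apply Nat.mod_upper_bound; lia|].
    split; [lia|].
    set (q := (x / g)%nat).
    assert (Hq : x = (g * q + x mod g)%nat) by (apply Nat.div_mod; lia).
    (* Since [x = g * q + x mod g] and [s1 = s2 + g], these two elements differ by exactly
       [x mod g], a positive difference below [g]. *)
    exists (x + S q * s2)%nat, (s2 + q * s1)%nat. split; [|split].
    - apply Hadd; [exact Hx | apply additive_mul; auto; lia].
    - destruct (Nat.eq_dec q 0) as [->|Hq0]; [now rewrite Nat.add_0_r|].
      apply Hadd; [exact H2 | apply additive_mul; auto; lia].
    - subst s1. nia. }
  assert (Hmg : m = g).
  { apply Nat.divide_antisym; [|exact Hgm].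
    destruct (Hdiv s1 H1) as [u Hu]. destruct (Hdiv s2 H2) as [v Hv].
    exists (u - v)%nat. rewrite Nat.mul_sub_distr_r. lia. }
  destruct (Hdiv s2 H2) as [c Hc].
  destruct (Nat.eq_dec c 0) as [Hc0|Hc0].
  - exists 1%nat. intros q Hq. rewrite Nat.mul_comm.
    apply additive_mul; auto. replace m with s1; [exact H1 | lia].
  - exists (c * c + c)%nat. intros q Hq.
    set (u := (q / c)%nat). set (b := (q mod c)%nat).
    assert (Hqc : q = (c * u + b)%nat) by (apply Nat.div_mod; lia).
    assert (Hb : (b < c)%nat) by (apply Nat.mod_upper_bound; lia).
    assert (Hu : (c <= u)%nat).
    { destruct (le_lt_dec c u) as [|Hlt]; [assumption|]. nia. }
    replace (m * q)%nat with ((u - b) * s2 + b * s1)%nat.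
    + destruct (Nat.eq_dec b 0) as [Hb0|Hb0].
      * rewrite Hb0, Nat.mul_0_l, Nat.add_0_r. apply additive_mul; auto; lia.
      * apply Hadd; apply additive_mul; auto; lia.
    + rewrite Hqc. subst s1 s2. rewrite <- Hmg.
      replace u with (b + (u - b))%nat at 2 by lia.
      generalize (u - b)%nat. intros w. ring.
Qed.

(** Congruence modulo [m], with multiples on both sides so that no truncated subtraction occurs and
    witnesses simply add up. *)
Definition congr (m k k' : nat) : Prop :=
  exists q q', (k + m * q = k' + m * q')%nat.

(** * Uniform bounds over finitely many coordinates *)

Lemma Idx_finite (n : nat) : exists l : list (Idx n), forall j, In j l.
Proof.
  assert (H : forall p, exists l : list (Idx n),
    forall j, (proj1_sig j < p)%nat -> In j l).
  { induction p as [|p [l IH]]; [exists nil; intros; lia|].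
    destruct (le_lt_dec n p) as [Hle|Hlt].
    - exists l. intros [j Hj] _. apply IH. simpl. lia.
    - exists (exist _ p Hlt :: l). intros [j Hj] Hjp. simpl in Hjp.
      destruct (Nat.eq_dec j p) as [->|Hne].
      + left. f_equal. apply le_unique.
      + right. apply IH. simpl. lia. }
  destruct (H n) as [l Hl]. exists l. intros j. apply Hl. apply (proj2_sig j).
Qed.

(** An abstract maximum over the indices: the first hypothesis joins two bounds into one, and [a0]
    starts the induction over the list of indices. *)
Lemma finite_uniform (n : nat) (A : Type) (P : Idx n -> A -> Prop) (a0 : A) :
  (forall a b, exists c, forall j, P j a \/ P j b -> P j c) ->
  (forall j, exists a, P j a) -> exists a, forall j, P j a.
Proof.
  intros Hjoin Hex. destruct (Idx_finite n) as [l Hl].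
  assert (H : exists a, forall j, In j l -> P j a).
  { clear Hl. induction l as [|i l [a IH]]; [exists a0; intros j []|].
    destruct (Hex i) as [b Hb]. destruct (Hjoin a b) as [c Hc].
    exists c. intros j [<-|Hj]; apply Hc; auto. }
  destruct H as [a Ha]. exists a. auto.
Qed.

Lemma finite_uniform_nat (n : nat) (P : Idx n -> nat -> Prop) :
  (forall j, exists N, forall k, (N <= k)%nat -> P j k) ->
  exists N, forall j k, (N <= k)%nat -> P j k.
Proof.
  intros H. apply (finite_uniform n nat (fun j N => forall k, (N <= k)%nat -> P j k) 0%nat).
  - intros a b. exists (max a b). intros j [Hj|Hj] k Hk; apply Hj; lia.
  - exact H.
Qed.

Lemma finite_uniform_pos (n : nat) (P : Idx n -> R -> Prop) :
  (forall j, exists e, 0 < e /\ forall e', 0 < e' <= e -> P j e') ->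
  exists e, 0 < e /\ forall j, P j e.
Proof.
  intros H.
  destruct (finite_uniform n {e : R | 0 < e}
    (fun j e => forall e', 0 < e' <= proj1_sig e -> P j e') (exist _ 1 Rlt_0_1))
    as [[e He] Hj].
  - intros [a Ha] [b Hb]. exists (exist _ (Rmin a b) (Rmin_pos _ _ Ha Hb)). simpl.
    intros j [Hj|Hj] e' He'; apply Hj.
    + pose proof (Rmin_l a b). lra.
    + pose proof (Rmin_r a b). lra.
  - intros j. destruct (H j) as [e [He Hj]]. now exists (exist _ e He).
  - exists e. split; [exact He|]. intros j. apply Hj. simpl. lra.
Qed.

(** * Compactness, cluster points and uniform continuity *)

Section Dynamics.
Variables (X : Type) (d : X -> X -> R).
Hypothesis Hd : is_metric X d.
Hypothesis Hcpt : compact_space X d.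

Lemma d_ge0 x y : 0 <= d x y.
Proof. apply Hd. Qed.
Lemma d_refl x : d x x = 0.
Proof. now apply Hd. Qed.
Lemma d_sym x y : d x y = d y x.
Proof. apply Hd. Qed.
Lemma d_tri x y z : d x z <= d x y + d y z.
Proof. apply Hd. Qed.

(** Otherwise each point has a ball which the sequence avoids from some time on. Finitely many of
    these balls cover [X], and a term past all their times lies in none of them. *)
Lemma cluster_point (x : nat -> X) :
  exists p, forall e N, 0 < e -> exists k, (N <= k)%nat /\ d (x k) p < e.
Proof.
  apply NNPP. intros Hno.
  assert (H : forall p, exists e N, 0 < e /\ forall k, (N <= k)%nat -> e <= d (x k) p).
  { intros p. apply NNPP. intros Hp. apply Hno. exists p. intros e N He.
    apply NNPP. intros Hk. apply Hp. exists e, N. split; [exact He|].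
    intros k HNk. apply Rnot_lt_le. intros Hlt. apply Hk. now exists k. }
  destruct (choice (fun p e => exists N, 0 < e /\
      forall k, (N <= k)%nat -> e <= d (x k) p) H) as [e He].
  destruct (choice (fun p N => 0 < e p /\
      forall k, (N <= k)%nat -> e p <= d (x k) p) He) as [N HN].
  destruct (Hcpt X (fun p y => d p y < e p)) as [l Hl].
  - intros p y Hy. exists (e p - d p y). split; [lra|]. intros z Hz.
    pose proof (d_tri p y z). lra.
  - intros y. exists y. rewrite d_refl. apply HN.
  - assert (HM : exists M, forall p, In p l -> (N p <= M)%nat).
    { clear Hl. induction l as [|p l [M IH]]; [exists 0%nat; intros p []|].
      exists (max (N p) M). intros q [<-|Hq]; [lia|]. specialize (IH q Hq). lia. }
    destruct HM as [M HM]. destruct (Hl (x M)) as [p [Hp Hlt]].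
    destruct (HN p) as [_ HNp]. specialize (HNp M (HM p Hp)).
    rewrite d_sym in HNp. lra.
Qed.

(** The bound [k <= phi k] takes the place of monotonicity: it is stable under composition and sends
    tails into tails. *)
Lemma convergent_subsequence (x : nat -> X) :
  exists p (phi : nat -> nat), (forall k, (k <= phi k)%nat) /\
    forall e, 0 < e -> exists N, forall k, (N <= k)%nat -> d (x (phi k)) p < e.
Proof.
  destruct (cluster_point x) as [p Hp]. exists p.
  destruct (choice (fun k i => (k <= i)%nat /\ d (x i) p < / INR (S k))) as [phi Hphi].
  { intros k. apply Hp. apply inv_INR_S_pos. }
  exists phi. split; [apply Hphi|]. intros e He.
  destruct (small_inv e He) as [N HN]. exists N. intros k Hk.
  apply Rlt_trans with (/ INR (S k)); [apply Hphi | now apply HN].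
Qed.

(** The subsequence is thinned once per coordinate, so that compactness of [X] alone suffices. *)
Lemma cluster_tuple (n : nat) (v : nat -> tuple X n) :
  exists w : tuple X n, forall e N, 0 < e ->
    exists k, (N <= k)%nat /\ close_n X d n w (v k) e.
Proof.
  destruct (Idx_finite n) as [l Hl].
  assert (H : exists (phi : nat -> nat), (forall k, (k <= phi k)%nat) /\
    forall j, In j l -> exists p, forall e, 0 < e ->
      exists N, forall k, (N <= k)%nat -> d (v (phi k) j) p < e).
  { clear Hl. induction l as [|i l (phi & Hphi & IH)].
    { exists (fun k => k). split; [auto | intros j []]. }
    destruct (convergent_subsequence (fun k => v (phi k) i)) as (p & psi & Hpsi & Hp).
    exists (fun k => phi (psi k)). split.
    - intros k. specialize (Hpsi k). specialize (Hphi (psi k)). lia.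
    - intros j [<-|Hj]; [exists p; exact Hp|].
      destruct (IH j Hj) as [q Hq]. exists q. intros e He.
      destruct (Hq e He) as [N HN]. exists N. intros k Hk. apply HN.
      specialize (Hpsi k). lia. }
  destruct H as (phi & Hphi & Hconv).
  destruct (choice (fun j p => forall e, 0 < e ->
      exists N, forall k, (N <= k)%nat -> d (v (phi k) j) p < e)) as [w Hw].
  { intros j. now apply Hconv. }
  exists w. intros e N He.
  destruct (finite_uniform_nat n (fun j k => d (v (phi k) j) (w j) < e)) as [M HM].
  { intros j. now apply Hw. }
  exists (phi (max N M)). split; [specialize (Hphi (max N M)); lia|].
  intros j. rewrite d_sym. apply HM. lia.
Qed.

Variable f : X -> X.
Hypothesis Hf : continuous_map X d f.

Lemma uniform_continuity (e : R) : 0 < e ->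
  exists g, 0 < g /\ forall x y, d x y < g -> d (f x) (f y) < e.
Proof.
  intros He. apply NNPP. intros Hno.
  assert (H : forall k, exists xy : X * X,
    d (fst xy) (snd xy) < / INR (S k) /\ e <= d (f (fst xy)) (f (snd xy))).
  { intros k. apply NNPP. intros Hk. apply Hno. exists (/ INR (S k)).
    split; [apply inv_INR_S_pos|]. intros x y Hxy. apply Rnot_le_lt. intros Hle.
    apply Hk. now exists (x, y). }
  destruct (choice _ H) as [xy Hxy].
  destruct (cluster_point (fun k => fst (xy k))) as [p Hp].
  destruct (Hf p (e / 2)) as [g [Hg Hcont]]; [lra|].
  destruct (small_inv (g / 2)) as [N HN]; [lra|].
  destruct (Hp (g / 2) N) as [k [HNk Hk]]; [lra|]. cbv beta in Hk.
  specialize (HN k HNk). destruct (Hxy k) as [H1 H2].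
  set (x := fst (xy k)) in *. set (y := snd (xy k)) in *.
  assert (Hx : d (f p) (f x) < e / 2) by (apply Hcont; pose proof (d_sym p x); lra).
  assert (Hy : d (f p) (f y) < e / 2).
  { apply Hcont. pose proof (d_tri p x y). pose proof (d_sym p x). lra. }
  pose proof (d_tri (f x) (f p) (f y)). pose proof (d_sym (f x) (f p)). lra.
Qed.

Lemma continuous_iter (i : nat) : continuous_map X d (iter X f i).
Proof.
  induction i as [|i IH]; intros x e He.
  - exists e. split; [exact He | auto].
  - destruct (Hf (iter X f i x) e He) as [g [Hg H1]].
    destruct (IH x g Hg) as [g' [Hg' H2]].
    exists g'. split; [exact Hg'|]. intros y Hy. apply H1, H2, Hy.
Qed.

Lemma iter_add (i k : nat) (x : X) : iter X f (i + k) x = iter X f i (iter X f k x).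
Proof. apply Nat.iter_add. Qed.

(** * Operations on chains *)

Local Notation chain := (chain_in X d f).
Local Notation everywhere := (fun _ : X => True).

Lemma chain_weaken (P Q : X -> Prop) e e' x y k :
  (forall z, P z -> Q z) -> e <= e' -> chain P e x y k -> chain Q e' x y k.
Proof.
  intros HPQ He (Hk & xs & H0 & H1 & HP & Hs). split; [exact Hk|].
  exists xs. repeat split; auto. intros i Hi. specialize (Hs i Hi). lra.
Qed.

Lemma chain_concat (P : X -> Prop) e x y z k l :
  chain P e x y k -> chain P e y z l -> chain P e x z (k + l).
Proof.
  intros (Hk & xs & H0 & H1 & HP & Hs) (Hl & ys & G0 & G1 & GP & Gs).
  split; [lia|].
  exists (fun i => if le_lt_dec i k then xs i else ys (i - k)%nat).
  repeat split.
  - destruct (le_lt_dec 0 k); [exact H0 | lia].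
  - destruct (le_lt_dec (k + l) k); [lia|]. now replace (k + l - k)%nat with l by lia.
  - intros i Hi. destruct (le_lt_dec i k); [apply HP | apply GP]; lia.
  - intros i Hi.
    destruct (le_lt_dec i k) as [Hik|Hik]; destruct (le_lt_dec (S i) k) as [Hik'|Hik'].
    + apply Hs. lia.
    + replace i with k by lia. rewrite H1, <- G0.
      replace (S k - k)%nat with 1%nat by lia. apply Gs. lia.
    + lia.
    + replace (S i - k)%nat with (S (i - k)) by lia. apply Gs. lia.
Qed.

Lemma chain_one (P : X -> Prop) e x y :
  P x -> P y -> d (f x) y <= e -> chain P e x y 1.
Proof.
  intros Hx Hy He. split; [lia|].
  exists (fun i => match i with O => x | _ => y end). repeat split.
  - intros [|i] _; assumption.
  - intros [|i] Hi; [exact He | lia].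
Qed.

Lemma chain_end (P : X -> Prop) e e' x y y' k :
  chain P e x y k -> P y' -> d y y' <= e' -> chain P (e + e') x y' k.
Proof.
  intros (Hk & xs & H0 & H1 & HP & Hs) Hy' He'. split; [exact Hk|].
  pose proof (d_ge0 y y').
  exists (fun i => if Nat.eq_dec i k then y' else xs i). repeat split.
  - destruct (Nat.eq_dec 0 k); [lia | exact H0].
  - now destruct (Nat.eq_dec k k).
  - intros i Hi. destruct (Nat.eq_dec i k); auto.
  - intros i Hi. destruct (Nat.eq_dec i k); [lia|]. specialize (Hs i Hi).
    destruct (Nat.eq_dec (S i) k) as [Hik|]; [|lra].
    rewrite Hik, H1 in Hs. pose proof (d_tri (f (xs i)) y y'). lra.
Qed.

(** Only the image of the initial point enters the first step, so the displacement is measured after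
    applying [f]. *)
Lemma chain_start (P : X -> Prop) e e' x x' y k :
  chain P e x y k -> P x' -> d (f x') (f x) <= e' -> chain P (e + e') x' y k.
Proof.
  intros (Hk & xs & H0 & H1 & HP & Hs) Hx' He'. split; [exact Hk|].
  pose proof (d_ge0 (f x') (f x)).
  exists (fun i => match i with O => x' | _ => xs i end). repeat split.
  - destruct k; [lia | exact H1].
  - intros [|i] Hi; auto.
  - intros [|i] Hi; specialize (Hs _ Hi); [|lra].
    rewrite H0 in Hs. pose proof (d_tri (f x') (f x) (xs 1%nat)). lra.
Qed.

Lemma chain_split (P : X -> Prop) e x y k (xs : nat -> X) i :
  xs 0%nat = x -> xs k = y -> (forall i, (i <= k)%nat -> P (xs i)) ->
  (forall i, (i < k)%nat -> d (f (xs i)) (xs (S i)) <= e) ->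
  (1 <= i < k)%nat -> chain P e x (xs i) i /\ chain P e (xs i) y (k - i).
Proof.
  intros H0 H1 HP Hs Hi. split; (split; [lia|]).
  - exists xs. repeat split; auto; intros; [apply HP | apply Hs]; lia.
  - exists (fun l => xs (i + l)%nat). repeat split.
    + now rewrite Nat.add_0_r.
    + now replace (i + (k - i))%nat with k by lia.
    + intros l Hl. apply HP. lia.
    + intros l Hl. replace (i + S l)%nat with (S (i + l)) by lia. apply Hs. lia.
Qed.

Lemma chain_orbit (P : X -> Prop) e x k :
  (forall z, P z -> P (f z)) -> 0 <= e -> P x -> (1 <= k)%nat ->
  chain P e x (iter X f k x) k.
Proof.
  intros HP He Hx Hk. split; [exact Hk|]. exists (fun i => iter X f i x).
  repeat split.
  - intros i _. induction i as [|i IH]; [exact Hx | apply HP, IH].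
  - intros i _. change (iter X f (S i) x) with (f (iter X f i x)). now rewrite d_refl.
Qed.

Lemma chain_to_trans x y z : chain_to X d f x y -> chain_to X d f y z -> chain_to X d f x z.
Proof.
  intros H1 H2 e He. destruct (H1 e He) as [k Hk]. destruct (H2 e He) as [l Hl].
  exists (k + l)%nat. eapply chain_concat; eassumption.
Qed.

Lemma chain_to_image x : chain_to X d f x (f x).
Proof. intros e He. exists 1%nat. apply chain_one; auto. rewrite d_refl. lra. Qed.

(** Drop the first step of a fine cycle at [x]: the next point is close to [f x], and continuity at
    [f x] lets the rest of the chain start there. *)
Lemma chain_from_image x : chain_recurrent X d f x -> chain_to X d f (f x) x.
Proof.
  intros Hx e He. destruct (Hf (f x) (e / 2)) as [g [Hg Hcont]]; [lra|].
  set (e' := Rmin (e / 2) (g / 2)).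
  assert (Hmin : 0 < e' /\ e' <= e / 2 /\ e' <= g / 2).
  { unfold e'. split; [apply Rmin_pos; lra | split; [apply Rmin_l | apply Rmin_r]]. }
  destruct (Hx e') as [k Hk]; [apply Hmin|].
  (* The cycle is run twice, so that at least one step remains after the first is dropped. *)
  pose proof (chain_concat _ _ _ _ _ _ _ Hk Hk) as (_ & xs & H0 & H1 & HP & Hs).
  destruct Hk as [Hk _].
  destruct (chain_split everywhere e' x x (k + k) xs 1) as [_ Hch]; auto; [lia|].
  exists (k + k - 1)%nat. apply chain_weaken with (P := everywhere) (e := e' + e / 2);
    [auto | lra |].
  apply chain_start with (x := xs 1%nat); auto.
  apply Rlt_le, Hcont. specialize (Hs 0%nat). rewrite H0 in Hs.
  apply Rle_lt_trans with e'; [apply Hs; lia | lra].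
Qed.

(** * Chain components and chain transitivity inside them *)

Variable C : X -> Prop.
Hypothesis HC : chain_component X d f C.

Lemma component_chain_to x y : C x -> C y -> chain_to X d f x y.
Proof.
  destruct HC as (x0 & _ & H). intros Hx Hy.
  apply H in Hx. apply H in Hy. apply chain_to_trans with x0; tauto.
Qed.

Lemma component_between x y p :
  C x -> C y -> chain_to X d f x p -> chain_to X d f p y -> C p.
Proof.
  intros Hx Hy Hxp Hpy.
  assert (Hyx : chain_to X d f y x) by now apply component_chain_to.
  destruct HC as (x0 & _ & H). apply H in Hx. apply H in Hy. apply H.
  destruct Hx as (_ & Hx1 & Hx2), Hy as (_ & Hy1 & Hy2). repeat split.
  - apply chain_to_trans with y; [exact Hpy|]. now apply chain_to_trans with x.
  - now apply chain_to_trans with x.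
  - now apply chain_to_trans with y.
Qed.

Lemma component_image x : C x -> C (f x).
Proof.
  intros Hx. apply component_between with x x; auto.
  - apply chain_to_image.
  - apply chain_from_image. now apply component_chain_to.
Qed.

Lemma component_iter i x : C x -> C (iter X f i x).
Proof. intros Hx. induction i as [|i IH]; [exact Hx | now apply component_image]. Qed.

(* A cluster point of points that lie on ever finer chains between two points
   of [C] is chain equivalent to them. *)
Lemma fine_chains_near_component x y g : C x -> C y -> 0 < g ->
  exists e0, 0 < e0 /\ forall e k xs, e <= e0 -> xs 0%nat = x -> xs k = y ->
    (forall i, (i < k)%nat -> d (f (xs i)) (xs (S i)) <= e) ->
    forall i, (i <= k)%nat -> exists c, C c /\ d (xs i) c < g.
Proof.
  intros Hx Hy Hg. apply NNPP. intros Hno.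
  assert (H : forall l, exists p,
    (exists i, chain everywhere (/ INR (S l)) x p i) /\
    (exists i, chain everywhere (/ INR (S l)) p y i) /\
    forall c, C c -> g <= d p c).
  { intros l. apply NNPP. intros Hl. apply Hno. exists (/ INR (S l)).
    split; [apply inv_INR_S_pos|]. intros e k xs He H0 H1 Hs i Hi.
    apply NNPP. intros Hc.
    assert (Hfar : forall c, C c -> g <= d (xs i) c).
    { intros c HCc. apply Rnot_lt_le. intros Hlt. apply Hc. now exists c. }
    assert (Hi0 : i <> 0%nat).
    { intros ->. specialize (Hfar x Hx). rewrite H0, d_refl in Hfar. lra. }
    assert (Hik : i <> k).
    { intros ->. specialize (Hfar y Hy). rewrite H1, d_refl in Hfar. lra. }
    destruct (chain_split everywhere (/ INR (S l)) x y k xs i) as [Ha Hb]; auto.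
    { intros i' Hi'. specialize (Hs i' Hi'). lra. }
    { lia. }
    apply Hl. exists (xs i). split; [|split]; eauto. }
  destruct (choice _ H) as [p Hp].
  destruct (cluster_point p) as [q Hq].
  assert (HqC : C q).
  { apply component_between with x y; auto; intros e He.
    - destruct (small_inv (e / 2)) as [N HN]; [lra|].
      destruct (Hq (e / 2) N) as [l [HNl Hl]]; [lra|]. specialize (HN l HNl).
      destruct (Hp l) as ([i Hi] & _ & _). exists i.
      apply chain_weaken with (P := everywhere) (e := / INR (S l) + e / 2);
        [auto | lra |].
      apply chain_end with (p l); auto. lra.
    - destruct (Hf q (e / 2)) as [g' [Hg' Hcont]]; [lra|].
      destruct (small_inv (e / 2)) as [N HN]; [lra|].
      destruct (Hq g' N) as [l [HNl Hl]]; [lra|]. specialize (HN l HNl).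
      destruct (Hp l) as (_ & [i Hi] & _). exists i.
      apply chain_weaken with (P := everywhere) (e := / INR (S l) + e / 2);
        [auto | lra |].
      apply chain_start with (p l); auto. apply Rlt_le, Hcont. now rewrite d_sym. }
  destruct (Hq g 0%nat Hg) as [l [_ Hl]]. destruct (Hp l) as (_ & _ & Hfar).
  specialize (Hfar q HqC). lra.
Qed.

(** Every point of a fine chain in [X] from [x] to [y] is moved to a nearby point of [C]. A new step
    costs [e / 3] for moving its source (uniform continuity), [e / 3] for the old step and [e / 3]
    for moving its target. *)
Lemma component_transitive e x y : 0 < e -> C x -> C y -> exists k, chain C e x y k.
Proof.
  intros He Hx Hy.
  destruct (uniform_continuity (e / 3)) as [g [Hg Hunif]]; [lra|].
  set (g' := Rmin g (e / 3)).
  assert (Hg' : 0 < g' /\ g' <= g /\ g' <= e / 3).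
  { unfold g'. split; [apply Rmin_pos; lra | split; [apply Rmin_l | apply Rmin_r]]. }
  destruct (fine_chains_near_component x y g' Hx Hy) as [e0 [He0 Hnear]]; [lra|].
  set (e1 := Rmin e0 (e / 3)).
  assert (He1 : 0 < e1 /\ e1 <= e0 /\ e1 <= e / 3).
  { unfold e1. split; [apply Rmin_pos; lra | split; [apply Rmin_l | apply Rmin_r]]. }
  destruct (component_chain_to x y Hx Hy e1) as [k (Hk & xs & H0 & H1 & _ & Hs)];
    [lra|].
  (* The endpoints are kept exactly; indices beyond [k] get the dummy value [x]. *)
  assert (Hc : forall i, exists c, C c /\ (i = 0%nat -> c = x) /\ (i = k -> c = y) /\
    ((i <= k)%nat -> d (xs i) c < g')).
  { intros i. destruct (Nat.eq_dec i 0) as [->|Hi0].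
    { exists x. repeat split; auto; [lia|]. intros _. rewrite H0, d_refl. lra. }
    destruct (Nat.eq_dec i k) as [->|Hik].
    { exists y. repeat split; auto; [lia|]. intros _. rewrite H1, d_refl. lra. }
    destruct (le_lt_dec i k) as [Hle|Hlt].
    - destruct (Hnear e1 k xs (proj1 (proj2 He1)) H0 H1 Hs i Hle) as [c [HCc Hd']].
      exists c. repeat split; auto; contradiction.
    - exists x. repeat split; auto; lia. }
  destruct (choice _ Hc) as [c Hcs].
  exists k. split; [exact Hk|]. exists c. repeat split.
  - now apply Hcs.
  - now apply Hcs.
  - intros i _. apply Hcs.
  - intros i Hi.
    destruct (Hcs i) as (_ & _ & _ & Hi1). destruct (Hcs (S i)) as (_ & _ & _ & Hi2).
    assert (d (f (xs i)) (f (c i)) < e / 3).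
    { apply Hunif. apply Rlt_le_trans with g'; [apply Hi1; lia | lra]. }
    specialize (Hs i Hi). specialize (Hi2 Hi).
    pose proof (d_tri (f (c i)) (f (xs i)) (c (S i))).
    pose proof (d_tri (f (xs i)) (xs (S i)) (c (S i))).
    pose proof (d_sym (f (c i)) (f (xs i))). lra.
Qed.

Lemma cycle_gcd_exists e : exists m, cycle_gcd X d f C e m.
Proof.
  destruct (gcd_exists (fun k => exists x, C x /\ chain C e x x k)) as [m [H1 H2]].
  exists m. split.
  - intros x k Hx Hk. apply H1. eauto.
  - intros m' Hm'. apply H2. intros s (x & Hx & Hs). eauto.
Qed.

(** * Chain lengths modulo the gcd of the cycle lengths *)

Section Phases.
Variables (e : R) (m : nat).
Hypothesis He : 0 < e.
Hypothesis Hm : cycle_gcd X d f C e m.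

Lemma cycle_gcd_pos x : C x -> (0 < m)%nat.
Proof.
  intros Hx. destruct (component_transitive e x x He Hx Hx) as [k Hk].
  destruct (proj1 Hm x k Hx Hk) as [q Hq]. destruct Hk as [Hk _].
  destruct m; lia.
Qed.

(** One chain back from [y] to [x] closes both chains to cycles, whose lengths are multiples of
    [m]. *)
Lemma chain_length_congr x y k k' :
  C x -> C y -> chain C e x y k -> chain C e x y k' -> congr m k k'.
Proof.
  intros Hx Hy Hk Hk'. destruct (component_transitive e y x He Hy Hx) as [l Hl].
  destruct (proj1 Hm x (k + l)%nat Hx) as [q Hq]; [eapply chain_concat; eassumption|].
  destruct (proj1 Hm x (k' + l)%nat Hx) as [q' Hq']; [eapply chain_concat; eassumption|].
  exists q', q. nia.
Qed.

Lemma cycles_eventually x : C x ->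
  exists Q, forall q, (Q <= q)%nat -> chain C e x x (m * q).
Proof.
  intros Hx. apply (additive_eventually (fun k => chain C e x x k)).
  - intros a b. apply chain_concat.
  - destruct (component_transitive e x x He Hx Hx) as [k Hk]. exists k.
    split; [exact Hk | destruct Hk; lia].
  - intros s Hs. now apply (proj1 Hm x).
  - intros m' Hm'. apply (proj2 Hm). intros y k Hy Hk.
    destruct (component_transitive e x y He Hx Hy) as [i Hi].
    destruct (component_transitive e y x He Hy Hx) as [l Hl].
    (* The loop through [y] and the same loop with the cycle of length [k] inserted are both cycles
       at [x]. Hence the cycles at [x] alone already have gcd [m]. *)
    apply Nat.divide_add_cancel_r with (i + l)%nat.
    + apply Hm'. now apply chain_concat with y.
    + replace (i + l + k)%nat with (i + (k + l))%nat by lia.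
      apply Hm'. apply chain_concat with y; [exact Hi|]. now apply chain_concat with y.
Qed.

(** Here [k] stands for the residue modulo [m] shared by the lengths of all chains in [C] from [x]
    to [y]; residue 0 is the relation [sim_Cdelta]. *)
Definition phase (x y : X) (k : nat) : Prop :=
  C x /\ C y /\ exists k', chain C e x y k' /\ congr m k' k.

Lemma phase_chain x y k : C x -> C y -> chain C e x y k -> phase x y k.
Proof. intros Hx Hy Hk. repeat split; auto. exists k. split; auto. now exists 0%nat, 0%nat. Qed.

Lemma phase_congr x y k k' : phase x y k -> congr m k k' -> phase x y k'.
Proof.
  intros (Hx & Hy & l & Hl & a & b & Hab) (a' & b' & Hab').
  repeat split; auto. exists l. split; [exact Hl|].
  exists (a + a')%nat, (b + b')%nat. nia.
Qed.

Lemma phase_trans x y z k l : phase x y k -> phase y z l -> phase x z (k + l).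
Proof.
  intros (Hx & Hy & k' & Hk & a & b & Hab) (_ & Hz & l' & Hl & a' & b' & Hab').
  repeat split; auto. exists (k' + l')%nat. split; [now apply chain_concat with y|].
  exists (a + a')%nat, (b + b')%nat. nia.
Qed.

Lemma phase_unique x y k l : phase x y k -> phase x y l -> congr m k l.
Proof.
  intros (Hx & Hy & k' & Hk & a & b & Hab) (_ & _ & l' & Hl & a' & b' & Hab').
  destruct (chain_length_congr x y k' l' Hx Hy Hk Hl) as (u & v & Huv).
  exists (b + u + a')%nat, (a + v + b')%nat. nia.
Qed.

(** Any chain from [y] to [z] has some residue, and uniqueness of the residue from [x] to [z]
    determines it. *)
Lemma phase_cancel x y z k l : phase x y k -> phase x z (k + l) -> phase y z l.
Proof.
  intros Hxy Hxz. assert (Hy : C y) by apply Hxy. assert (Hz : C z) by apply Hxz.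
  destruct (component_transitive e y z He Hy Hz) as [j Hj].
  pose proof (phase_chain y z j Hy Hz Hj) as Hyz.
  apply phase_congr with j; [exact Hyz|].
  destruct (phase_unique x z (k + j) (k + l)) as (u & v & Huv); auto.
  { now apply phase_trans with y. }
  exists u, v. lia.
Qed.

Lemma phase_iter x i : C x -> phase x (iter X f i x) i.
Proof.
  intros Hx. assert (Hix := component_iter i x Hx).
  destruct i as [|i].
  (* Chains have positive length, so residue 0 is realised by a cycle. *)
  - destruct (component_transitive e x x He Hx Hx) as [k Hk].
    apply phase_congr with k; [now apply phase_chain|].
    destruct (proj1 Hm x k Hx Hk) as [q Hq]. exists 0%nat, q. nia.
  - apply phase_chain; auto. apply chain_orbit; auto; [apply component_image | lra | lia].
Qed.

(** A fixed chain of the right residue is preceded by a cycle at [x], whose length can be any large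
    multiple of [m]. *)
Lemma phase_chain_eventually x y k : phase x y k ->
  exists K, forall l, (K <= l)%nat -> congr m l k -> chain C e x y l.
Proof.
  intros (Hx & Hy & k' & Hk & a & b & Hab).
  destruct (cycles_eventually x Hx) as [Q HQ]. pose proof (cycle_gcd_pos x Hx).
  exists (k' + m * Q)%nat. intros l Hl (u & v & Huv).
  assert (Hq : exists q, (Q <= q)%nat /\ (l = m * q + k')%nat).
  (* Eliminating [k] from the two congruences gives [l = k' + m * (v + a - b - u)]. *)
  { exists (v + a - (b + u))%nat.
    assert (m * (b + u) + m * Q <= m * (v + a))%nat by nia.
    assert (b + u + Q <= v + a)%nat by nia.
    split; [lia|]. rewrite Nat.mul_sub_distr_l. nia. }
  destruct Hq as (q & HqQ & ->). apply chain_concat with x; auto.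
Qed.

Lemma sim_phase x y : sim_Cdelta X d f C e x y -> phase x y 0.
Proof.
  intros (Hx & Hy & m' & Hm' & k & [q Hq] & Hk).
  assert (m' = m).
  { apply Nat.divide_antisym; [apply Hm, Hm' | apply Hm', Hm]. }
  subst m'. apply phase_congr with k; [now apply phase_chain|].
  exists 0%nat, q. nia.
Qed.

Lemma phase_sim x y : phase x y 0 -> sim_Cdelta X d f C e x y.
Proof.
  intros Hxy. assert (Hx : C x) by apply Hxy. assert (Hy : C y) by apply Hxy.
  destruct (phase_chain_eventually x y 0 Hxy) as [K HK].
  pose proof (cycle_gcd_pos x Hx).
  repeat split; auto. exists m. split; [exact Hm|].
  exists (m * K)%nat. split; [apply Nat.divide_factor_l|].
  apply HK; [nia|]. exists 0%nat, K. lia.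
Qed.

(** Both iterates are taken within [e / 2] of one cluster point of the orbit of [x] under the [m]-th
    iterate of [f]. *)
Lemma recurrent_multiples x : exists l1, forall L, exists l,
  (L <= l)%nat /\ d (iter X f (m * l1) x) (iter X f (m * l) x) <= e.
Proof.
  destruct (cluster_point (fun l => iter X f (m * l) x)) as [p Hp].
  destruct (Hp (e / 2) 0%nat) as [l1 [_ H1]]; [lra|]. exists l1. intros L.
  destruct (Hp (e / 2) L) as [l [HL H2]]; [lra|]. exists l. split; [exact HL|].
  cbv beta in *. pose proof (d_tri (iter X f (m * l1) x) p (iter X f (m * l) x)).
  pose proof (d_sym p (iter X f (m * l) x)). lra.
Qed.

(* The target [f^(t+k) u] depends on the length [k]; recurrence along the
   multiples of [m] gives one fixed target that serves for infinitely many [k]. *)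
Lemma chain_into_orbit u x t : phase u x t ->
  exists k, chain C (e + e) x (iter X f (t + k) u) k.
Proof.
  intros Hux. assert (Hu : C u) by apply Hux. assert (Hx : C x) by apply Hux.
  pose proof (cycle_gcd_pos x Hx) as Hmpos.
  destruct (recurrent_multiples u) as [l1 Hl1].
  set (g := iter X f (m * l1) u) in *. assert (Hg : C g) by now apply component_iter.
  destruct (component_transitive e x g He Hx Hg) as [k0 Hk0].
  assert (Hxg : phase x g k0) by now apply phase_chain.
  destruct (phase_chain_eventually x g k0 Hxg) as [K HK].
  destruct (Hl1 (t + K)%nat) as [l [Hl Hdist]].
  assert (Hml : (t + K <= m * l)%nat) by nia.
  exists (m * l - t)%nat.
  replace (t + (m * l - t))%nat with (m * l)%nat by lia.
  apply chain_end with g; [|now apply component_iter | exact Hdist].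
  apply HK; [lia|].
  destruct (phase_unique u g (t + k0) (m * l1)) as (a & b & Hab).
  { now apply phase_trans with x. }
  { now apply phase_iter. }
  exists (l1 + b)%nat, (l + a)%nat. nia.
Qed.
End Phases.

(** * Classes of the component and their stable sets *)

Lemma class_base (E : X -> Prop) : D_class X d f C E ->
  exists u, E u /\ C u /\ forall y, E y -> C y /\ sim_C X d f C u y.
Proof.
  intros (u & Hu & HE). exists u. split; [|split; [exact Hu | apply HE]].
  apply HE. split; [exact Hu|]. intros e He.
  destruct (cycle_gcd_exists e) as [m Hm].
  apply (phase_sim e m He Hm). now apply (phase_iter e m He Hm u 0).
Qed.

(** The point [b] is the [i]-th iterate of a point equivalent to [u] at scale [e], and each
    application of [f] raises the phase by one. *)
Lemma Vs_phase (E : X -> Prop) u z e m : E u -> Vs X d f C E z ->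
  0 < e -> cycle_gcd X d f C e m ->
  exists N, forall i, (N <= i)%nat ->
    exists b, phase e m u b i /\ d (iter X f i z) b < e.
Proof.
  intros Hu Hz He Hm. destruct (Hz e He) as [_ H].
  destruct (H u Hu e He) as [N HN]. exists N. intros i Hi.
  destruct (HN i Hi) as [b [Hb Hdist]]. exists (iter X f i b). split; [|exact Hdist].
  assert (HCb : C b) by apply Hb.
  change i with (0 + i)%nat at 2. apply phase_trans with b.
  - now apply sim_phase.
  - now apply phase_iter.
Qed.

Definition asymptotic (x y : X) : Prop :=
  forall e, 0 < e -> exists N, forall i, (N <= i)%nat ->
    d (iter X f i x) (iter X f i y) < e.

(** The orbit of [u] is itself the orbit to be approached, for every scale and every [y] in [E];
    symmetry of the relation comes from [phase_cancel]. *)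
Lemma asymptotic_Vs (E : X -> Prop) u v :
  (forall y, E y -> C y /\ sim_C X d f C u y) -> C u -> asymptotic v u ->
  Vs X d f C E v.
Proof.
  intros HE Hu Hv e He. split.
  - intros e' He'. destruct (Hv e' He') as [N HN]. exists N. intros i Hi.
    exists (iter X f i u). split; [now apply component_iter | now apply HN].
  - intros y Hy e' He'. destruct (Hv e' He') as [N HN]. exists N. intros i Hi.
    exists u. split; [|now apply HN].
    destruct (cycle_gcd_exists e) as [m Hm]. apply (phase_sim e m He Hm).
    destruct (HE y Hy) as [_ Hsim].
    apply phase_cancel with (x := u) (k := 0%nat); auto.
    + apply sim_phase; auto.
    + now apply (phase_iter e m He Hm u 0).
Qed.

(** * Pseudo-orbits and their limit shadows *)

Hypothesis Hsh : s_limit_shadowing X d f.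

(** The second chain joins the orbit of [u] at time [s + N + k] exactly at the iterate of that
    index. From then on the pseudo-orbit has no error, so its limit shadow is asymptotic to [u] and
    not to a shift of [u]. *)
Lemma shadow_window rho : 0 < rho -> exists e, 0 < e /\
  forall z x u s N k,
    chain everywhere e z x s ->
    chain everywhere e (iter X f N x) (iter X f (s + N + k) u) k ->
    exists v, d v z <= rho /\
      (forall i, (i <= N)%nat -> d (iter X f (s + i) v) (iter X f i x) <= rho) /\
      asymptotic v u.
Proof.
  intros Hrho. destruct (Hsh rho Hrho) as [e [He Hshadow]].
  exists e. split; [exact He|].
  intros z x u s N k (Hs & g & G0 & G1 & _ & Hg) (Hk & h & H0 & H1 & _ & Hh).
  (* Four pieces: chain, orbit of [x], chain, orbit of [u]. Neighbouring pieces agree where they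
     meet, so each formula below also holds at its right end. *)
  set (xs := fun i =>
    if le_lt_dec s i then
      if le_lt_dec (s + N) i then
        if le_lt_dec (s + N + k) i then iter X f i u else h (i - (s + N))%nat
      else iter X f (i - s) x
    else g i).
  assert (Hwin : forall i, (i <= N)%nat -> xs (s + i)%nat = iter X f i x).
  { intros i Hi. unfold xs.
    destruct (le_lt_dec s (s + i)); [|lia].
    destruct (le_lt_dec (s + N) (s + i)).
    - destruct (le_lt_dec (s + N + k) (s + i)); [lia|].
      replace i with N by lia. now rewrite Nat.sub_diag.
    - f_equal. lia. }
  assert (Hend : forall i, (s + N + k <= i)%nat -> xs i = iter X f i u).
  { intros i Hi. unfold xs.
    destruct (le_lt_dec s i); [|lia]. destruct (le_lt_dec (s + N) i); [|lia].
    destruct (le_lt_dec (s + N + k) i); [reflexivity | lia]. }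
  assert (Hg' : forall i, (i <= s)%nat -> xs i = g i).
  { intros i Hi. destruct (Nat.eq_dec i s) as [->|Hne].
    - rewrite <- (Nat.add_0_r s) at 1. rewrite Hwin by lia. now rewrite G1.
    - unfold xs. destruct (le_lt_dec s i); [lia | reflexivity]. }
  assert (Hh' : forall i, (i <= k)%nat -> xs (s + N + i)%nat = h i).
  { intros i Hi. destruct (Nat.eq_dec i k) as [->|Hne].
    - rewrite Hend by lia. now rewrite H1.
    - unfold xs. destruct (le_lt_dec s (s + N + i)); [|lia].
      destruct (le_lt_dec (s + N) (s + N + i)); [|lia].
      destruct (le_lt_dec (s + N + k) (s + N + i)); [lia|].
      f_equal. lia. }
  assert (Hexact : forall i, (s + N + k <= i)%nat -> d (f (xs i)) (xs (S i)) = 0).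
  { intros i Hi. rewrite !Hend by lia.
    change (iter X f (S i) u) with (f (iter X f i u)). apply d_refl. }
  destruct (Hshadow xs) as [v [Hv1 Hv2]].
  - intros i. destruct (le_lt_dec s i) as [Hi|Hi].
    + destruct (le_lt_dec (s + N) i) as [Hi'|Hi'].
      * destruct (le_lt_dec (s + N + k) i) as [Hi2|Hi2].
        { rewrite Hexact by assumption. lra. }
        replace i with (s + N + (i - (s + N)))%nat by lia.
        rewrite <- Nat.add_succ_r, !Hh' by lia. apply Hh. lia.
      * replace i with (s + (i - s))%nat by lia.
        rewrite <- Nat.add_succ_r, !Hwin by lia.
        change (iter X f (S (i - s)) x) with (f (iter X f (i - s) x)).
        rewrite d_refl. lra.
    + rewrite !Hg' by lia. now apply Hg.
  - intros e' He'. exists (s + N + k)%nat. intros i Hi. now rewrite Hexact.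
  - exists v. split; [|split].
    + specialize (Hv1 0%nat). rewrite Hg', G0 in Hv1 by lia. exact Hv1.
    + intros i Hi. rewrite <- Hwin by assumption. apply Hv1.
    + intros e' He'. destruct (Hv2 e' He') as [M HM].
      exists (max M (s + N + k)). intros i Hi.
      rewrite <- Hend by lia. apply HM. lia.
Qed.

(* All the coordinates are steered with the same times [s] and [t], which do
   not depend on the length [N] of the window in which [a] is followed. *)
Lemma follow_then_asymptotic (n : nat) (D E : X -> Prop) (z a : tuple X n) u rho :
  D_class X d f C D -> E u -> C u ->
  (forall j, Vs X d f C E (z j)) -> (forall j, Vs X d f C D (a j)) -> 0 < rho ->
  exists s t, forall N, exists v : tuple X n, forall j,
    d (v j) (z j) <= rho /\
    (forall i, (i <= N)%nat ->
      d (iter X f (s + i) (v j)) (iter X f (t + i) (a j)) <= rho) /\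
    asymptotic (v j) u.
Proof.
  intros HD HEu Hu Hz Ha Hrho.
  destruct (class_base D HD) as (p & Hp & HCp & _).
  destruct (shadow_window rho Hrho) as [e2 [He2 Hwindow]].
  (* Half of [e2], because a chain step and a displaced endpoint may each cost [e]. *)
  set (e := e2 / 2). assert (He : 0 < e) by (unfold e; lra).
  assert (Hee : e + e <= e2) by (unfold e; lra).
  destruct (cycle_gcd_exists e) as [m Hm].
  pose proof (cycle_gcd_pos e m He Hm u Hu) as Hmpos.
  destruct (component_transitive e u p He Hu HCp) as [q Hq].
  assert (Hup : phase e m u p q) by now apply phase_chain.
  destruct (finite_uniform_nat n
    (fun j i => exists b, phase e m u b i /\ d (iter X f i (z j)) b < e)) as [N1 HN1].
  { intros j. now apply Vs_phase with E. }
  destruct (finite_uniform_nat n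
    (fun j i => exists b, phase e m p b i /\ d (iter X f i (a j)) b < e)) as [N2 HN2].
  { intros j. now apply Vs_phase with D. }
  (* The successor makes the initial orbit segment a chain of positive length. *)
  set (M := S N1).
  (* Follow [z j] for [M] steps to near [b] in [C], then take a chain in [C] to [c] near the [N2]-th
     iterate of [a j]. The phase of [c] from [u] is [q + N2] for every [j], so one residue of total
     lengths fits all coordinates. *)
  destruct (finite_uniform_nat n (fun j k => congr m (M + k) (q + N2) ->
    chain everywhere e2 (z j) (iter X f N2 (a j)) (M + k))) as [K HK].
  { intros j. destruct (HN1 j M) as [b [Hb Hzb]]; [unfold M; lia|].
    destruct (HN2 j N2) as [c [Hc Hac]]; [lia|].
    assert (Huc : phase e m u c (q + N2)) by now apply phase_trans with p.
    assert (HCb : C b) by apply Hb. assert (HCc : C c) by apply Hc.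
    destruct (component_transitive e b c He HCb HCc) as [l Hl].
    assert (Hbc : phase e m b c l) by now apply phase_chain.
    destruct (phase_chain_eventually e m He Hm b c l Hbc) as [K HK].
    exists K. intros k Hk Hcong.
    apply chain_concat with b.
    - apply chain_weaken with (P := everywhere) (e := 0 + e); [auto | lra |].
      apply chain_end with (iter X f M (z j)); [|auto | lra].
      apply chain_orbit; auto; [lra | unfold M; lia].
    - apply chain_weaken with (P := everywhere) (e := e + e); [auto | lra |].
      apply chain_end with c; [|auto | rewrite d_sym; lra].
      apply chain_weaken with (P := C) (e := e); [auto | lra |].
      apply HK; [exact Hk|].
      destruct (phase_unique e m He Hm u c (M + l) (q + N2)) as (x & y & Hxy); auto.
      { now apply phase_trans with b. }
      destruct Hcong as (x' & y' & Hxy').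
      exists (x' + y)%nat, (x + y')%nat. nia. }
  (* Chosen so that [k >= K] and [M + k] exceeds [q + N2] by a multiple of [m]. *)
  set (k := (q + N2 + M * (m - 1) + m * K)%nat).
  assert (Hk : (M + k = q + N2 + m * (M + K))%nat).
  { unfold k. destruct m as [|m']; [lia|].
    replace (S m' - 1)%nat with m' by lia. ring. }
  exists (M + k)%nat, N2. intros N. apply (choice (fun j v =>
    d v (z j) <= rho /\
    (forall i, (i <= N)%nat ->
      d (iter X f (M + k + i) v) (iter X f (N2 + i) (a j)) <= rho) /\
    asymptotic v u)).
  (* One step after the window the orbit of [a j] is near [b], whose phase from [u] is the current
     time [M + k + N + 1]. This is the phase needed to rejoin the orbit of [u] without a time
     shift. *)
  intros j. destruct (HN2 j (S (N + N2))) as [b [Hb Hab]]; [lia|].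
  assert (Hub : phase e m u b (M + k + N + 1)).
  { apply phase_congr with (q + S (N + N2))%nat; [now apply phase_trans with p|].
    exists (M + K)%nat, 0%nat. lia. }
  destruct (chain_into_orbit e m He Hm u b _ Hub) as [l Hl].
  destruct (Hwindow (z j) (iter X f N2 (a j)) u (M + k)%nat N (1 + l)%nat)
    as (v & Hv1 & Hv2 & Hv3).
  - apply HK; [unfold k; nia|]. exists 0%nat, (M + K)%nat. lia.
  - apply chain_concat with b.
    + apply chain_one; auto. rewrite <- iter_add.
      change (f (iter X f (N + N2) (a j))) with (iter X f (S (N + N2)) (a j)). lra.
    + rewrite Nat.add_assoc. apply chain_weaken with (P := C) (e := e + e); auto.
  - exists v. split; [exact Hv1|]. split; [|exact Hv3].
    intros i Hi. rewrite (Nat.add_comm N2), (iter_add i N2). now apply Hv2.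
Qed.

(** * Separation and proximality sets in Furstenberg families *)

Lemma S_f_open (n : nat) r : open_n X d n
  (fun w => forall j k : Idx n, (proj1_sig j < proj1_sig k)%nat -> d (w j) (w k) > r).
Proof.
  intros z Hz.
  destruct (finite_uniform_pos n (fun j e => forall k : Idx n,
    (proj1_sig j < proj1_sig k)%nat -> r + 2 * e <= d (z j) (z k))) as [e [He H]].
  { intros j.
    destruct (finite_uniform_pos n (fun k e =>
      (proj1_sig j < proj1_sig k)%nat -> r + 2 * e <= d (z j) (z k))) as [e [He H]].
    - intros k. destruct (lt_dec (proj1_sig j) (proj1_sig k)) as [Hjk|Hjk].
      + specialize (Hz j k Hjk). exists ((d (z j) (z k) - r) / 2).
        split; [lra|]. intros e' He' _. lra.
      + exists 1. split; [lra|]. intros e' _ Hlt. contradiction.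
    - exists e. split; [exact He|]. intros e' He' k Hjk. specialize (H k Hjk). lra. }
  exists e. split; [exact He|]. intros w Hw j k Hjk.
  specialize (H j k Hjk). pose proof (Hw j). pose proof (Hw k).
  pose proof (d_tri (z j) (w j) (z k)). pose proof (d_tri (w j) (w k) (z k)).
  pose proof (d_sym (w k) (z k)). lra.
Qed.

Lemma T_f_open (n : nat) r : open_n X d n
  (fun w => forall j k : Idx n, (proj1_sig j < proj1_sig k)%nat -> d (w j) (w k) < r).
Proof.
  intros z Hz.
  destruct (finite_uniform_pos n (fun j e => forall k : Idx n,
    (proj1_sig j < proj1_sig k)%nat -> d (z j) (z k) + 2 * e <= r)) as [e [He H]].
  { intros j.
    destruct (finite_uniform_pos n (fun k e =>
      (proj1_sig j < proj1_sig k)%nat -> d (z j) (z k) + 2 * e <= r)) as [e [He H]].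
    - intros k. destruct (lt_dec (proj1_sig j) (proj1_sig k)) as [Hjk|Hjk].
      + specialize (Hz j k Hjk). exists ((r - d (z j) (z k)) / 2).
        split; [lra|]. intros e' He' _. lra.
      + exists 1. split; [lra|]. intros e' _ Hlt. contradiction.
    - exists e. split; [exact He|]. intros e' He' k Hjk. specialize (H k Hjk). lra. }
  exists e. split; [exact He|]. intros w Hw j k Hjk.
  specialize (H j k Hjk). pose proof (Hw j). pose proof (Hw k).
  pose proof (d_tri (w j) (z j) (w k)). pose proof (d_tri (z j) (z k) (w k)).
  pose proof (d_sym (w j) (z j)). lra.
Qed.

(** For fixed [i] the bound holds for all [v N] with [N >= i]; it is a closed condition, so it
    passes to the cluster point. *)
Lemma iter_cluster (n : nat) (w : tuple X n) (v : nat -> tuple X n) (a : tuple X n) s t rho :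
  (forall e N, 0 < e -> exists k, (N <= k)%nat /\ close_n X d n w (v k) e) ->
  (forall N j i, (i <= N)%nat ->
    d (iter X f (s + i) (v N j)) (iter X f (t + i) (a j)) <= rho) ->
  forall j i, d (iter X f (s + i) (w j)) (iter X f (t + i) (a j)) <= rho.
Proof.
  intros Hw Hv j i. apply Rnot_lt_le. intros Hlt.
  set (e := d (iter X f (s + i) (w j)) (iter X f (t + i) (a j)) - rho).
  destruct (continuous_iter (s + i) (w j) e) as [g [Hg Hcont]]; [unfold e; lra|].
  destruct (Hw g i Hg) as [k [Hk Hclose]].
  specialize (Hcont (v k j) (Hclose j)). specialize (Hv k j i Hk).
  pose proof (d_tri (iter X f (s + i) (w j)) (iter X f (s + i) (v k j))
    (iter X f (t + i) (a j))).
  unfold e in Hcont. lra.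
Qed.

(** Shift the separation times of [a] back by [t] and forward by [s]; at these times [w] loses at
    most [2 * rho] of the separation. *)
Lemma F_of_following (F : ffamily) (n : nat) (w a : tuple X n) s t rho r delta :
  furstenberg F -> translation_invariant F -> r + 2 * rho <= delta ->
  (forall j i, d (iter X f (s + i) (w j)) (iter X f (t + i) (a j)) <= rho) ->
  F (S_f d f n a delta) -> F (S_f d f n w r).
Proof.
  intros (_ & _ & Hup) Hti Hr Hw HS.
  pose proof (proj1 (Hti _ s (proj2 (Hti _ t HS)))) as H.
  apply (Hup _ _ H). intros l (i & Hi & ->) j k Hjk.
  specialize (Hi j k Hjk). rewrite (Nat.add_comm i s). rewrite (Nat.add_comm i t) in Hi.
  pose proof (Hw j i). pose proof (Hw k i).
  set (aj := iter X f (t + i) (a j)) in *. set (ak := iter X f (t + i) (a k)) in *.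
  set (wj := iter X f (s + i) (w j)) in *. set (wk := iter X f (s + i) (w k)) in *.
  pose proof (d_tri aj wj ak). pose proof (d_tri wj wk ak).
  pose proof (d_sym aj wj). lra.
Qed.

(** A full family contains every cofinite set: cut any member down to a tail and enlarge. *)
Lemma G_of_asymptotic (G : ffamily) (n : nat) (v : tuple X n) u e :
  furstenberg G -> full_family G -> (forall j, asymptotic (v j) u) -> 0 < e ->
  G (T_f d f n v e).
Proof.
  intros ([A HA] & _ & Hup) Hfull Hv He.
  destruct (finite_uniform_nat n
    (fun j i => d (iter X f i (v j)) (iter X f i u) < e / 2)) as [N HN].
  { intros j. apply Hv. lra. }
  apply (Hup _ _ (Hfull A N HA)). intros i [_ Hi] j k Hjk.
  pose proof (HN j i Hi). pose proof (HN k i Hi).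
  pose proof (d_tri (iter X f i (v j)) (iter X f i u) (iter X f i (v k))).
  pose proof (d_sym (iter X f i u) (iter X f i (v k))). lra.
Qed.

Lemma residual_of_open_sequence (n : nat) (Y : X -> Prop) (A : tuple X n -> Prop)
  (O : nat -> tuple X n -> Prop) :
  (forall k, open_n X d n (O k)) ->
  (forall k z e, power_set_n X n Y z -> 0 < e ->
    exists w, O k w /\ power_set_n X n Y w /\ close_n X d n z w e) ->
  (forall z, (forall k, O k z) -> A z) -> residual_in_n X d n Y A.
Proof.
  intros Hopen Hdense HA. exists (fun k z => O k z /\ power_set_n X n Y z).
  split; [|split].
  - intros k. split; [now intros z [_ Hz]|]. intros z [Hz _].
    destruct (Hopen k z Hz) as [e [He H]]. exists e. split; [exact He|].
    intros w Hw Hclose. split; auto.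
  - intros k z e Hz He. destruct (Hdense k z e Hz He) as (w & H1 & H2 & H3).
    exists w. auto.
  - intros z Hz. apply HA. intros k. apply Hz.
Qed.
End Dynamics.

(** * Assembly of the countably many dense open sets *)

Theorem theorem1p4 (X : Type) (d : X -> X -> R)
  (Hd : is_metric X d) (Hcpt : compact_space X d)
  (f : X -> X) (Hf : continuous_map X d f) (Hsh : s_limit_shadowing X d f)
  (C : X -> Prop) (HC : chain_component X d f C)
  (D : X -> Prop) (HD : D_class X d f C D)
  (F G : ffamily)
  (HF : furstenberg F) (HG : furstenberg G)
  (HFfull : full_family F) (HGfull : full_family G)
  (HFcomp : forall m, (2 <= m)%nat -> compatible d f F m)
  (HGcomp : forall m, (2 <= m)%nat -> compatible d f G m)
  (HFti : translation_invariant F)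
  (n : nat) (Hn : (2 <= n)%nat) (delta : R) (Hdelta : 0 < delta)
  (a : tuple X n) (Ha : forall j, Vs X d f C D (a j))
  (HS : F (S_f d f n a delta)) :
  forall E : X -> Prop, D_class X d f C E ->
  forall r : R, 0 < r < delta ->
  generic_chaotic d f F G n r (Vs X d f C E).
Proof.
  intros E HE r Hr.
  destruct (class_base X d Hd Hcpt f Hf C HC E HE) as (u & HEu & Hu & Hclass).
  assert (HVs : forall v, asymptotic X d f v u -> Vs X d f C E v).
  { intros v. now apply (asymptotic_Vs X d Hd Hcpt f Hf C HC E u v). }
  split.
  { exists u. apply HVs. intros e He. exists 0%nat. intros i _.
    now rewrite (d_refl X d Hd). }
  destruct (HFcomp n Hn _ (S_f_open X d Hd n r)) as (OS & HOS & HSr).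
  assert (HT : forall k, exists O : nat -> tuple X n -> Prop,
    (forall l, open_n X d n (O l)) /\
    forall z, G (T_f d f n z (/ INR (S k))) <-> forall l, O l z).
  { intros k. exact (HGcomp n Hn _ (T_f_open X d Hd n (/ INR (S k)))). }
  destruct (choice _ HT) as [OT HOT].
  (* Cantor pairing merges the open sets into one sequence: first component 0 codes the condition on
     [F], and [S k] the condition on [G] at scale [/ INR (S k)]. *)
  apply residual_of_open_sequence with (O := fun i =>
    let (k, l) := Cantor.of_nat i in
    match k with O => OS l | S k' => OT k' l end).
  - intros i. destruct (Cantor.of_nat i) as [[|k] l]; [apply HOS | apply HOT].
  - intros i z e Hz He.
    (* The first bound keeps [v N] strictly within [e] of [z], the second gives
       [r + 2 * rho <= delta]. *)
    set (rho := Rmin (e / 2) ((delta - r) / 2)).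
    assert (Hrho : 0 < rho /\ rho <= e / 2 /\ rho <= (delta - r) / 2).
    { unfold rho. split; [apply Rmin_pos; lra | split; [apply Rmin_l | apply Rmin_r]]. }
    destruct (follow_then_asymptotic X d Hd Hcpt f Hf C HC Hsh n D E z a u rho)
      as (s & t & Hv); auto; [lra|].
    destruct (choice _ Hv) as [v Hvs].
    assert (HvE : forall N, power_set_n X n (Vs X d f C E) (v N)).
    { intros N j. apply HVs, Hvs. }
    assert (Hvz : forall N, close_n X d n z (v N) e).
    { intros N j. destruct (Hvs N j) as [H _]. rewrite (d_sym X d Hd). lra. }
    destruct (Cantor.of_nat i) as [[|k] l].
    + destruct (cluster_tuple X d Hd Hcpt n v) as [w Hw].
      assert (HSw : F (S_f d f n w r)).
      { apply (F_of_following X d Hd f F n w a s t rho r delta); auto; [lra|].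
        apply (iter_cluster X d Hd f Hf n w v a s t rho Hw).
        intros N j. apply Hvs. }
      destruct (HOS l w (proj1 (HSr w) HSw l)) as [g [Hg Hopen]].
      destruct (Hw g 0%nat Hg) as [N [_ HN]]. exists (v N). auto.
    (* Every [v N] is asymptotic to [u] in all coordinates, so any window length will do. *)
    + exists (v 0%nat). split; [|auto]. apply HOT.
      apply (G_of_asymptotic X d Hd f G n (v 0%nat) u); auto.
      * intros j. apply Hvs.
      * apply inv_INR_S_pos.
  - intros z Hz. split.
    + apply HSr. intros l. specialize (Hz (Cantor.to_nat (0%nat, l))).
      now rewrite Cantor.cancel_of_to in Hz.
    + intros e He. destruct (small_inv e He) as [k Hk].
      destruct HG as (_ & _ & Hup). apply Hup with (T_f d f n z (/ INR (S k))).
      * apply HOT. intros l. specialize (Hz (Cantor.to_nat (S k, l))).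
        now rewrite Cantor.cancel_of_to in Hz.
      * intros i Hi j j' Hjj'. specialize (Hk k (le_n k)). specialize (Hi j j' Hjj'). lra.
Qed.
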